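(* Let $\ell\ge 1$ and let $G$ be a finite subgraph of the $\mathbb{Z}^\ell$ lattice with $n$ vertices. Then \[\operatorname{pd}(G)\le n\left(1-\frac{1}{2\ell+1}\right).\]
   Context: The $\mathbb{Z}^\ell$ lattice is the infinite graph whose vertices are the points of $\mathbb{R}^\ell$ with integer coordinates, two vertices being adjacent when they are at Euclidean distance $1$. For a finite simple graph $G$ with vertex set $\{x_1,\dots,x_n\}$ and a fixed field $\mathbf{k}$, $S=\mathbf{k}[x_1,\dots,x_n]$, $I(G)=(x_ix_j:(x_i,x_j)\in E(G))$ is the edge ideal, and $\operatorname{pd}(G)$ is the projective dimension of $S/I(G)$. *)

(* Defs.v *)
From HB Require Import structures.
From mathcomp Require Import all_boot all_order all_algebra.
From mathcomp Require Import mpoly.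
Set Implicit Arguments. Unset Strict Implicit. Unset Printing Implicit Defensive.
Import Order.TTheory GRing.Theory Num.Theory.
Local Open Scope ring_scope.

Definition lattice_adj (l : nat) (p q : {ffun 'I_l -> int}) : bool :=
  \sum_(c < l) (p c - q c) ^+ 2 == 1.

Definition in_edge_ideal (k : fieldType) (n : nat) (e : rel 'I_n)
  (f : {mpoly k[n]}) : Prop :=
  exists c : 'I_n -> 'I_n -> {mpoly k[n]},
    f = \sum_(i < n) \sum_(j < n | e i j) c i j * 'X_i * 'X_j.

(* A finite free resolution of S/I(G) of length <= p:
     0 -> ... -> F_2 --d 0--> F_1 --g--> F_0 = S -> S/I(G) -> 0
   with F_{i+1} = S^(r i) (row vectors, maps act by right multiplication),
   F_{i+1} = 0 for i >= p, image of g equal to I(G), and exactness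
   at every F_j with j >= 1. *)
Definition free_resolution (k : fieldType) (n : nat) (e : rel 'I_n) (p : nat)
  (r : nat -> nat) (g : 'M[{mpoly k[n]}]_(r 0, 1))
  (d : forall i, 'M[{mpoly k[n]}]_(r i.+1, r i)) : Prop :=
  (forall i, (p <= i)%N -> r i = 0%N) /\
      (forall f, in_edge_ideal e f <-> exists v : 'rV_(r 0), f = (v *m g) 0 0) /\
      d 0%N *m g = 0 /\
      (forall i, d i.+1 *m d i = 0) /\
      (forall v : 'rV_(r 0), v *m g = 0 -> exists w : 'rV_(r 1), v = w *m d 0%N) /\
      (forall i (v : 'rV_(r i.+1)), v *m d i = 0 ->
         exists w : 'rV_(r i.+2), v = w *m d i.+1).

Definition pd_le (k : fieldType) (n : nat) (e : rel 'I_n) (p : nat) : Prop :=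
  exists (r : nat -> nat) (g : 'M[{mpoly k[n]}]_(r 0, 1))
         (d : forall i, 'M[{mpoly k[n]}]_(r i.+1, r i)),
    free_resolution e p g d.

(* Main.v *)
(** For a vertex x of a graph on W, the ideal J = I(W) equals B + xA, where
    B = I(W - x) and A = (J : x) is generated by the neighbours of x together
    with I(W - N[x]).  Since x is regular modulo B, J is an extension of B/xB
    by xA, and the horseshoe construction yields
    pd(W) <= max(pd(W - N[x]) + deg x, pd(W - x) + 1).

    Rank the vertices, let y have the largest rank and delete its neighbours
    by increasing rank.  If x is the i-th of them and i + deg x <= d + 1, then
    splitting off the closed neighbourhood of x costs at most d in projective
    dimension, counting the i - 1 vertices deleted before, and removes one
    vertex more than it costs.  Once all of them are deleted y is isolated and
    leaves for free, with the same balance, so pd <= n d / (d + 1).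

    In a lattice graph rank p by its height, the sum of (c + 1) p_c, which
    separates the 2l unit steps.  If the step from x to y has height t, the
    neighbours of x ranked no higher than y come from steps of height at most
    t, and the neighbours of y ranked no higher than x from steps of height at
    least t.  Only one step has height t, so there are at most 2l + 1 of them
    in all, and d = 2l will do. *)
Require Import Defs.
From mathcomp Require Import mpoly zify.
From mathcomp Require Import all_boot all_order all_algebra.

Set Implicit Arguments.
Unset Strict Implicit.
Unset Printing Implicit Defensive.
Import Order.TTheory GRing.Theory Num.Theory.
Local Open Scope ring_scope.

Section Resolutions.
Variable R : comNzRingType.

Definition row_module r m (M : 'M[R]_(r, m)) (v : 'rV_m) : Prop :=
  exists w : 'rV_r, v = w *m M.

Definition exact_mx s r m (N : 'M[R]_(s, r)) (M : 'M_(r, m)) : Prop :=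
  N *m M = 0 /\ forall v : 'rV_r, v *m M = 0 -> row_module N v.

(* The cokernel of [M] has a free resolution of length at most [p] whose first
   differential is [M]. *)
Fixpoint resolvable (p r m : nat) (M : 'M[R]_(r, m)) : Prop :=
  if p is p'.+1 then
    exists s (N : 'M[R]_(s, r)), exact_mx N M /\ resolvable p' N
  else r = 0%N.

Lemma row_module_row r m (M : 'M[R]_(r, m)) i : row_module M (row i M).
Proof. by exists (delta_mx 0 i); rewrite rowE. Qed.

Lemma row_module_col_mx r1 r2 m (M1 : 'M[R]_(r1, m)) (M2 : 'M_(r2, m)) v :
  row_module (col_mx M1 M2) v <->
  exists v1 v2, [/\ row_module M1 v1, row_module M2 v2 & v = v1 + v2].
Proof.
split=> [[w ->]|[_ [_ [[w1 ->] [w2 ->] ->]]]]; last first.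
  by exists (row_mx w1 w2); rewrite mul_row_col.
rewrite -[w]hsubmxK mul_row_col.
by exists (lsubmx w *m M1), (rsubmx w *m M2); split=> //; eexists.
Qed.

Lemma row_module_scale (x : R) r m (M : 'M[R]_(r, m)) v :
  row_module (x *: M) v <-> exists2 u, row_module M u & v = x *: u.
Proof.
split=> [[w ->]|[_ [w ->] ->]]; last by exists w; rewrite scalemxAr.
by exists (w *m M); [exists w | rewrite scalemxAr].
Qed.

Lemma mulmx_factor s r m (X : 'M[R]_(s, m)) (Y : 'M_(r, m)) :
  (forall i, row_module Y (row i X)) -> exists Z, X = Z *m Y.
Proof.
move=> /fin_all_exists [f fP]; exists (\matrix_i f i).
by apply/row_matrixP => i; rewrite row_mul rowK fP.
Qed.

Lemma scalemx_lreg0 (x : R) r m (M : 'M[R]_(r, m)) :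
  GRing.lreg x -> x *: M = 0 -> M = 0.
Proof.
move=> x_reg /matrixP xM0; apply/matrixP => i j; apply: x_reg.
by have := xM0 i j; rewrite !mxE mulr0.
Qed.

Lemma exact_mx00 r m (N : 'M[R]_(r, 0)) (M : 'M_(0, m)) : exact_mx N M.
Proof.
split=> [|v _]; first by rewrite thinmx0 mul0mx.
by exists 0; rewrite !thinmx0.
Qed.

Lemma exact_mx01 m : exact_mx (0 : 'M[R]_(0, m)) 1%:M.
Proof. by split=> [|v]; rewrite mulmx1 // => ->; exists 0; rewrite mul0mx. Qed.

Lemma resolvable_no_row p m (M : 'M[R]_(0, m)) : resolvable p M.
Proof.
elim: p m M => //= p IHp m M.
by exists 0%N, 0; split; [apply: exact_mx00 | apply: IHp].
Qed.

Lemma resolvable_leq p q r m (M : 'M[R]_(r, m)) :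
  (p <= q)%N -> resolvable p M -> resolvable q M.
Proof.
elim: p q r m M => [|p IHp] [|q] r m M //.
  by move=> _ /= r0; subst r; apply: (resolvable_no_row q.+1).
by move=> /IHp le_pq [s [N [NM /le_pq resN]]]; exists s, N.
Qed.

(* The hypothesis on [T] says that the connecting map from the kernel of [Q]
   to the cokernel of [P] vanishes. *)
Lemma resolvable_horseshoe p rQ rP mQ mP (Q : 'M[R]_(rQ, mQ))
    (T : 'M_(rQ, mP)) (P : 'M_(rP, mP)) :
  (forall v : 'rV_rQ, v *m Q = 0 -> row_module P (v *m T)) ->
  resolvable p Q -> resolvable p P -> resolvable p (block_mx Q T 0 P).
Proof.
elim: p rQ rP mQ mP Q T P => [|p IHp] rQ rP mQ mP Q T P kerT /=.
  by move=> -> ->.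
case=> sQ [Q' [[Q'Q kerQ] resQ]] [sP [P' [[P'P kerP] resP]]].
have [T' T'P] : exists T', - (Q' *m T) = T' *m P.
  apply: mulmx_factor => i.
  have [|w wP] := kerT (row i Q'); first by rewrite -row_mul Q'Q row0.
  by exists (- w); rewrite linearN /= row_mul wP mulNmx.
exists (sQ + sP)%N, (block_mx Q' T' 0 P'); split; last first.
  apply: IHp resQ resP => v vQ'; apply: kerP.
  by rewrite -mulmxA -T'P mulmxN mulmxA vQ' mul0mx oppr0.
split=> [|v].
  by rewrite mulmx_block Q'Q P'P -T'P !mul0mx !mulmx0 !addr0 subrr block_mx0.
rewrite -[v]hsubmxK mul_row_block mulmx0 addr0 -row_mx0.
move=> /eq_row_mx [/kerQ [w vE] uE].
have /kerP [z zE] : (rsubmx v - w *m T') *m P = 0.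
  by rewrite mulmxBl -mulmxA -T'P mulmxN opprK mulmxA -vE addrC; exact: uE.
exists (row_mx w z).
by rewrite mul_row_block mulmx0 addr0 -vE -zE addrC subrK.
Qed.

Section Colon.
Variables (x : R) (rA rB m : nat) (gA : 'M[R]_(rA, m)) (gB : 'M[R]_(rB, m)).
Hypotheses (x_reg : GRing.lreg x)
  (subBA : forall b, row_module gB b -> row_module gA b)
  (colonB :
     forall a, row_module gA a -> row_module gB (x *: a) -> row_module gB a).

Lemma exact_mx_colon s t (N : 'M_(s, rB)) (P : 'M_(t, rA)) (F : 'M_(rB, rA)) :
  gB = F *m gA -> exact_mx N gB -> exact_mx P gA ->
  exact_mx (block_mx (col_mx N x%:M) (col_mx 0 (- F)) 0 P)
           (col_mx gB (x *: gA)).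
Proof.
move=> FE [NB kerB] [PA kerA]; split=> [|v].
  rewrite mul_block_col !mul_col_mx NB mul_scalar_mx !mul0mx add0r mulNmx.
  by rewrite -!scalemxAr -FE PA scaler0 add_col_mx addr0 subrr !col_mx0.
rewrite -[v]hsubmxK mul_row_col -scalemxAr.
set b := lsubmx v; set a := rsubmx v => /eqP; rewrite addrC addr_eq0 => /eqP vE.
have [||w wE] := colonB (a := a *m gA); first by exists a.
  by exists (- b); rewrite vE mulNmx.
have /kerB [y yE] : (b + x *: w) *m gB = 0.
  by rewrite mulmxDl -scalemxAl -wE vE subrr.
have /kerA [z zE] : (a - w *m F) *m gA = 0.
  by rewrite mulmxBl -mulmxA -FE wE subrr.
exists (row_mx (row_mx y (- w)) z).
rewrite mul_row_block !mul_row_col mul_mx_scalar !mulmx0 addr0 add0r.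
by rewrite mulNmx mulmxN opprK -yE -zE scalerN addrK addrC subrK.
Qed.

(* With B and A the row modules of [gB] and [gA], the module B + xA is an
   extension of B / xB, presented by [col_mx N x%:M], by xA. *)
Lemma resolvable_colon_of_quotient p s (N : 'M_(s, rB)) :
  exact_mx N gB -> resolvable p (col_mx N x%:M) -> resolvable p.+1 gA ->
  resolvable p.+1 (col_mx gB (x *: gA)).
Proof.
move=> NB resN [t [P [PA resP]]].
have [F FE] : exists F, gB = F *m gA.
  by apply: mulmx_factor => i; apply/subBA/row_module_row.
do 2 eexists; split; first exact: exact_mx_colon FE NB PA.
apply: resolvable_horseshoe resN resP => v; rewrite -[v]hsubmxK !mul_row_col.
rewrite mul_mx_scalar mulmx0 add0r addrC => /eqP; rewrite addr_eq0 => /eqP vE.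
apply: PA.2; rewrite -mulmxA mulNmx -FE mulmxN.
suff -> : rsubmx v *m gB = 0 by rewrite oppr0.
apply: scalemx_lreg0 x_reg _.
by rewrite scalemxAl vE mulNmx -mulmxA NB.1 mulmx0 oppr0.
Qed.

End Colon.

(* The quotient B / xB is itself presented by a sum N + xF, with F free and N
   the syzygies of B, so the induction runs along a resolution of B. *)
Lemma resolvable_colon (x : R) p rA rB m (gA : 'M[R]_(rA, m))
    (gB : 'M_(rB, m)) :
  GRing.lreg x -> (forall b, row_module gB b -> row_module gA b) ->
  (forall a, row_module gA a -> row_module gB (x *: a) -> row_module gB a) ->
  resolvable p.+1 gA -> resolvable p gB ->
  resolvable p.+1 (col_mx gB (x *: gA)).
Proof.
move=> x_reg; elim: p rA rB m gA gB => [|p IHp] rA rB m gA gB subBA colonB resA.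
  move=> /= rB0; subst rB.
  by apply: resolvable_colon_of_quotient (exact_mx00 (0 : 'M_0) gB) _ resA.
case=> s [N [NB resN]].
apply: resolvable_colon_of_quotient (NB) _ resA => //.
rewrite -scalemx1; apply: IHp resN => [b _|_ [w ->]|].
- by exists b; rewrite mulmx1.
- case=> v vE; apply: NB.2; apply: scalemx_lreg0 x_reg _.
  by rewrite scalemxAl vE -mulmxA NB.1 mulmx0.
by exists 0%N, 0; split; [apply: exact_mx01 | apply: resolvable_no_row].
Qed.

Lemma resolvable_chain p r0 m (M : 'M[R]_(r0, m)) :
  resolvable p M ->
  exists (r : nat -> nat) (g : 'M[R]_(r 0, m))
         (d : forall i, 'M[R]_(r i.+1, r i)),
    [/\ forall i, (p <= i)%N -> r i = 0%N,
        forall v, row_module g v <-> row_module M v,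
        exact_mx (d 0%N) g & forall i, exact_mx (d i.+1) (d i)].
Proof.
elim: p r0 m M => [|p IHp] r0 m M /=.
  move=> r0_0; subst r0; exists (fun=> 0%N), M, (fun=> 0).
  by split=> [||| i] //; apply: exact_mx00.
case=> s [N [[NM kerM] /IHp [r [g [d [r0E gN exg exd]]]]]].
pose r' i := if i is j.+1 then r j else r0.
pose d' i : 'M[R]_(r' i.+1, r' i) :=
  match i return 'M[R]_(r' i.+1, r' i) with 0 => g | j.+1 => d j end.
exists r', M, d'; split=> //; first by case.
  split=> [|v /kerM /gN //]; apply/row_matrixP => i; rewrite row_mul row0.
  have /gN [w ->] := row_module_row g i.
  by rewrite -mulmxA NM mulmx0.
by case.
Qed.

End Resolutions.

Section MonomialIdeals.
Variables (R : comNzRingType) (n : nat).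
Local Notation S := {mpoly R[n]}.
Implicit Types (U : pred 'X_{1..n}) (m : 'X_{1..n}) (f g : S) (x : 'I_n).

(* Monomial ideals are encoded by their up-sets of exponent vectors. *)
Definition up_closed U : Prop := forall m1 m2, U m1 -> U (m1 + m2)%MM.

Definition in_monomial_ideal U f : Prop := forall m, ~~ U m -> f@_m = 0.

Definition monomial_pd_le U p : Prop :=
  exists r (g : 'M[S]_(r, 1)),
    (forall v, row_module g v <-> in_monomial_ideal U (v 0 0)) /\
    resolvable p g.

Definition zero_exponent x m : 'X_{1..n} :=
  [multinom if i == x then 0%N else m i | i < n].

Definition colon_upset x U : pred 'X_{1..n} := fun m => U (m + U_(x))%MM.

Definition deletion_upset x U : pred 'X_{1..n} :=
  fun m => U (zero_exponent x m).

Lemma in_monomial_ideal_sub U V f :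
  subpred U V -> in_monomial_ideal U f -> in_monomial_ideal V f.
Proof. by move=> UV Uf m nVm; apply: Uf; apply: contra nVm => /UV. Qed.

Lemma in_monomial_ideal0 U : in_monomial_ideal U 0.
Proof. by move=> m _; rewrite mcoeff0. Qed.

Lemma in_monomial_idealD U f g :
  in_monomial_ideal U f -> in_monomial_ideal U g -> in_monomial_ideal U (f + g).
Proof. by move=> Uf Ug m nUm; rewrite mcoeffD Uf ?Ug ?addr0. Qed.

Lemma in_monomial_idealM U f g :
  up_closed U -> in_monomial_ideal U f -> in_monomial_ideal U (g * f).
Proof.
move=> upU Uf m nUm; rewrite mulrC mcoeffM big1 // => ij /eqP mE.
rewrite Uf ?mul0r //; apply: contra nUm => Ui.
by rewrite mE; apply: upU.
Qed.

Lemma in_monomial_idealZX U c m : U m -> in_monomial_ideal U (c *: 'X_[m]).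
Proof.
move=> Um m' nUm'; rewrite mcoeffZ mcoeffX.
by case: eqP nUm' => [<-|_]; rewrite ?Um ?mulr0.
Qed.

Lemma in_monomial_ideal_ind U (Q : S -> Prop) :
  Q 0 -> (forall f g, Q f -> Q g -> Q (f + g)) ->
  (forall c m, U m -> Q (c *: 'X_[m])) ->
  forall f, in_monomial_ideal U f -> Q f.
Proof.
move=> Q0 QD QX f Uf; rewrite [f]mpolyE; apply: big_ind => // m _.
by have [/QX // | /Uf ->] := boolP (U m); rewrite scale0r.
Qed.

Lemma in_monomial_ideal_mulX U x f :
  in_monomial_ideal U ('X_x * f) <->
  in_monomial_ideal (colon_upset x U) f.
Proof.
split=> [UXf m nUm|].
  by rewrite -(mcoeffMX f U_(x)) addmC mulrC UXf.
move: f; apply: in_monomial_ideal_ind => [|f g Uf Ug|c m Um].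
- by rewrite mulr0; apply: in_monomial_ideal0.
- by rewrite mulrDr; apply: in_monomial_idealD.
by rewrite -scalerAr -mpolyXD addmC; apply: in_monomial_idealZX.
Qed.

Lemma lreg_mpolyX x : GRing.lreg ('X_x : S).
Proof.
move=> f g /mpolyP fg; apply/mpolyP => m.
rewrite -(mcoeffMX f U_(x)) -(mcoeffMX g U_(x)) mulrC [g * _]mulrC.
exact: fg.
Qed.

Lemma zero_exponentD1 x m : zero_exponent x (m + U_(x)) = zero_exponent x m.
Proof.
by apply/mnmP => i; rewrite !mnmE; case: eqVneq => // ix; rewrite addn0.
Qed.

Lemma zero_exponent_id x m : m x = 0%N -> zero_exponent x m = m.
Proof. by move=> mx; apply/mnmP => i; rewrite mnmE; case: eqP => // ->. Qed.

Lemma zero_exponentW U x m : up_closed U -> U (zero_exponent x m) -> U m.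
Proof.
move=> upU /upU -/(_ (m - zero_exponent x m)%MM); congr (U _).
rewrite addmC submK //; apply/mnm_lepP => i; rewrite mnmE.
by case: eqP.
Qed.

Lemma in_monomial_ideal_split U x f :
  up_closed U ->
  in_monomial_ideal U f <->
  exists b a, [/\ in_monomial_ideal (deletion_upset x U) b,
                  in_monomial_ideal (colon_upset x U) a &
                  f = b + 'X_x * a].
Proof.
move=> upU; split=> [|[b [a [Ub /in_monomial_ideal_mulX Ua ->]]]]; last first.
  apply: in_monomial_idealD Ua; apply: in_monomial_ideal_sub Ub => m.
  exact: zero_exponentW.
move: f; apply: in_monomial_ideal_ind => [||c m Um].
- by exists 0, 0; rewrite mulr0 addr0; split=> //; apply: in_monomial_ideal0.
- move=> _ _ [b [a [Ub Ua ->]]] [b' [a' [Ub' Ua' ->]]].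
  exists (b + b'), (a + a'); rewrite mulrDr addrACA.
  by split=> //; apply: in_monomial_idealD.
have [mx|mx] := eqVneq (m x) 0%N.
  exists (c *: 'X_[m]), 0; rewrite mulr0 addr0.
  split=> //; last exact: in_monomial_ideal0.
  by apply: in_monomial_idealZX; rewrite /deletion_upset zero_exponent_id.
have mE : (m - U_(x) + U_(x) = m)%MM by rewrite submK // lep1mP.
exists 0, (c *: 'X_[m - U_(x)]).
rewrite add0r -scalerAr -mpolyXD addmC mE.
split=> //; first exact: in_monomial_ideal0.
by apply: in_monomial_idealZX; rewrite /colon_upset mE.
Qed.

Lemma monomial_pd_le_colon U x p :
  up_closed U ->
  monomial_pd_le (colon_upset x U) p.+1 ->
  monomial_pd_le (deletion_upset x U) p ->
  monomial_pd_le U p.+1.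
Proof.
move=> upU [rA [gA [genA resA]]] [rB [gB [genB resB]]].
exists (rB + rA)%N, (col_mx gB ('X_x *: gA)); split; last first.
  apply: resolvable_colon resA resB; first exact: lreg_mpolyX.
    move=> b /genB Ub; apply/genA; apply: in_monomial_ideal_sub Ub => m Um.
    exact/upU/(zero_exponentW upU Um).
  move=> a _ /genB; rewrite mxE => /in_monomial_ideal_mulX Ua; apply/genB.
  apply: in_monomial_ideal_sub Ua => m.
  by rewrite /colon_upset /deletion_upset zero_exponentD1.
move=> v; split=> [/row_module_col_mx|].
  move=> [b [_ [/genB Ub /row_module_scale [a /genA Ua ->] ->]]].
  by apply/(in_monomial_ideal_split x) => //; exists (b 0 0), (a 0 0);
    rewrite !mxE.
move/(in_monomial_ideal_split x) => -/(_ upU) [b [a [Ub Ua vE]]].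
apply/row_module_col_mx; exists b%:M, ('X_x *: a%:M); split.
- by apply/genB; rewrite mxE.
- by apply/row_module_scale; exists a%:M => //; apply/genA; rewrite mxE.
by rewrite [v]mx11_scalar vE scale_scalar_mx -raddfD.
Qed.

Lemma eq_monomial_pd_le U V p :
  U =1 V -> monomial_pd_le U p -> monomial_pd_le V p.
Proof.
move=> UV [r [g [gU resg]]]; exists r, g; split=> // v; rewrite gU.
by split; apply: in_monomial_ideal_sub => m; rewrite UV.
Qed.

Lemma monomial_pd_leW U p q :
  (p <= q)%N -> monomial_pd_le U p -> monomial_pd_le U q.
Proof.
by move=> le_pq [r [g [gU /(resolvable_leq le_pq)]]]; exists r, g.
Qed.

Lemma monomial_pd_le_pred0 : monomial_pd_le pred0 0.
Proof.
exists 0%N, 0; split=> // v; split=> [[w ->] m _|v0].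
  by rewrite mulmx0 mxE mcoeff0.
exists 0; rewrite mulmx0 [v]mx11_scalar; apply/rowP => i; rewrite ord1 !mxE.
by apply/mpolyP => m; rewrite v0 // mcoeff0.
Qed.

Lemma monomial_pd_le_predT : monomial_pd_le predT 1.
Proof.
exists 1%N, 1%:M; split=> [v|].
  by split=> // _; exists v; rewrite mulmx1.
by exists 0%N, 0; split; first exact: exact_mx01.
Qed.

End MonomialIdeals.

Section SquarefreeIdeals.
Variables (R : comNzRingType) (n : nat).
Implicit Types (P : pred {set 'I_n}) (V Z : {set 'I_n}) (x : 'I_n).

Definition mnm_supp (m : 'X_{1..n}) : {set 'I_n} := [set i | (0 < m i)%N].

(* A squarefree monomial ideal is encoded by the supports of its monomials. *)
Definition squarefree_pd_le P p : Prop :=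
  monomial_pd_le R (fun m => P (mnm_supp m)) p.

Definition superset_closed P : Prop :=
  forall V1 V2, V1 \subset V2 -> P V1 -> P V2.

Lemma mnm_suppD m1 m2 : mnm_supp (m1 + m2) = mnm_supp m1 :|: mnm_supp m2.
Proof. by apply/setP => i; rewrite !inE mnmDE addn_gt0. Qed.

Lemma mnm_supp1 x : mnm_supp U_(x) = [set x].
Proof. by apply/setP => i; rewrite !inE mnm1E eq_sym lt0b. Qed.

Lemma mnm_supp_zero_exponent x m :
  mnm_supp (zero_exponent x m) = mnm_supp m :\ x.
Proof. by apply/setP => i; rewrite !inE mnmE; case: eqP. Qed.

Lemma squarefree_pd_le_colon P x p :
  superset_closed P ->
  squarefree_pd_le (fun V => P (x |: V)) p.+1 ->
  squarefree_pd_le (fun V => P (V :\ x)) p ->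
  squarefree_pd_le P p.+1.
Proof.
move=> upP pdA pdB; apply: (monomial_pd_le_colon (x := x)).
- by move=> m1 m2; apply: upP; rewrite mnm_suppD subsetUl.
- apply: eq_monomial_pd_le pdA => m.
  by rewrite /colon_upset mnm_suppD mnm_supp1 setUC.
apply: eq_monomial_pd_le pdB => m.
by rewrite /deletion_upset mnm_supp_zero_exponent.
Qed.

Lemma eq_squarefree_pd_le P Q p :
  P =1 Q -> squarefree_pd_le P p -> squarefree_pd_le Q p.
Proof. by move=> PQ; apply: eq_monomial_pd_le => m; rewrite PQ. Qed.

Lemma squarefree_pd_leW P p q :
  (p <= q)%N -> squarefree_pd_le P p -> squarefree_pd_le P q.
Proof. exact: monomial_pd_leW. Qed.

Lemma squarefree_pd_le_variable P x p :
  superset_closed P -> (forall V, P (V :\ x) = P V) ->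
  squarefree_pd_le P p ->
  squarefree_pd_le (fun V => P V || (x \in V)) p.+1.
Proof.
move=> upP Px pdP; apply: (squarefree_pd_le_colon (x := x)).
- move=> V1 V2 sV /orP[/(upP _ _ sV) -> // | xV].
  by rewrite (subsetP sV) ?orbT.
- apply: squarefree_pd_leW (ltn0Sn p) _.
  by apply: eq_monomial_pd_le (monomial_pd_le_predT R n) => m;
    rewrite setU11 orbT.
by apply: eq_squarefree_pd_le pdP => V; rewrite Px setD11 orbF.
Qed.

Lemma squarefree_pd_le_variables P Z p :
  superset_closed P -> (forall x V, x \in Z -> P (V :\ x) = P V) ->
  squarefree_pd_le P p ->
  squarefree_pd_le (fun V => P V || ~~ [disjoint Z & V]) (#|Z| + p).
Proof.
move=> upP; have [c] := ubnP #|Z|; elim: c Z => // c IHc Z leZ PZ pdP.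
have [->|[x xZ]] := set_0Vmem Z.
  rewrite cards0; apply: eq_squarefree_pd_le pdP => V.
  by rewrite eq_disjoint0 ?orbF // => x; rewrite inE.
rewrite (cardsD1 x) xZ in leZ *.
apply: eq_squarefree_pd_le (squarefree_pd_le_variable (x := x) _ _
    (IHc (Z :\ x) leZ _ pdP)) => [V|V1 V2 sV|V|z V /setD1P[_ /PZ //]].
- rewrite -orbA; congr (_ || _); rewrite -[x \in V]negbK -negb_and andbC.
  rewrite -[in RHS](setD1K xZ) -[in RHS]setI_eq0 setIUl setU_eq0 !setI_eq0.
  by rewrite disjoints1.
- case/orP=> [/(upP _ _ sV) -> // | dV]; apply/orP; right.
  by apply: contra dV; apply: disjointWr.
rewrite PZ //; congr (_ || ~~ _).
by rewrite -!setI_eq0 setIDA [(Z :\ x) :&: V]setIC setIDA setDDl setUid.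
Qed.

End SquarefreeIdeals.

Section Graphs.
Variables (T : finType) (e : rel T).
Implicit Types (V W : {set T}) (x y z : T).

Definition has_edge V : bool :=
  [exists x, exists y, [&& x \in V, y \in V & e x y]].

Definition nbrs W x : {set T} := [set z in W | e x z].

Lemma has_edgeP V :
  reflect (exists x y, [/\ x \in V, y \in V & e x y]) (has_edge V).
Proof.
by apply: (iffP existsP) => -[x]; [case/existsP | case] => y xyV; exists x;
  [exists y; apply/and3P | apply/existsP; exists y; apply/and3P].
Qed.

Lemma has_edgeS V W : V \subset W -> has_edge V -> has_edge W.
Proof.
move=> /subsetP sVW /has_edgeP[x [y [/sVW xW /sVW yW exy]]].
by apply/has_edgeP; exists x, y.
Qed.

Lemma has_edge0 : has_edge set0 = false.
Proof. by apply/has_edgeP => -[x [y []]]; rewrite inE. Qed.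

Lemma nbrsS V W x : V \subset W -> nbrs V x \subset nbrs W x.
Proof.
by move=> /subsetP sVW; apply/subsetP => z; rewrite !inE => /andP[/sVW -> ->].
Qed.

Hypotheses (e_sym : symmetric e) (e_irr : irreflexive e).

Lemma nbrs_sym W x y : y \in W -> x \in nbrs W y -> y \in nbrs W x.
Proof. by move=> yW; rewrite !inE yW e_sym => /andP[]. Qed.

Lemma nbrs_subD1 W x : nbrs W x \subset W :\ x.
Proof.
apply/subsetP => z; rewrite !inE => /andP[-> exz]; rewrite andbT.
by apply: contraTneq exz => ->; rewrite e_irr.
Qed.

Lemma has_edgeU1 W V x : x \in W ->
  has_edge (W :&: (x |: V)) =
  has_edge ((W :\ x :\: nbrs W x) :&: V) || ~~ [disjoint nbrs W x & V].
Proof.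
move=> xW; apply/idP/orP => [/has_edgeP[i [j []]]|]; last first.
  case; first by apply/has_edgeS/setISS; rewrite ?subsetUr // setDDl subsetDl.
  case/pred0Pn => z /= /andP[]; rewrite inE => /andP[zW exz] zV.
  by apply/has_edgeP; exists x, z; rewrite !inE xW zW zV eqxx orbT.
have [dV|/pred0Pn nd] := boolP [disjoint nbrs W x & V]; last by right.
have nV z : z \in W -> z \in V -> e x z = false.
  move=> zW zV; apply/negbTE/negP => exz.
  by have := disjointFl dV zV; rewrite inE zW exz.
rewrite !inE => /andP[iW iV] /andP[jW jV] eij; left.
have [ix|ix] := eqVneq i x.
  have [jx|jx] := eqVneq j x; first by rewrite ix jx e_irr in eij.
  by move: jV eij; rewrite (negbTE jx) ix => /(nV _ jW) ->.
have [jx|jx] := eqVneq j x.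
  by move: iV eij; rewrite (negbTE ix) jx e_sym => /(nV _ iW) ->.
move: iV jV; rewrite (negbTE ix) (negbTE jx) => /= iV jV.
apply/has_edgeP; exists i, j.
by rewrite !inE iW jW iV jV ix jx !nV.
Qed.

Lemma has_edge_isolated W V x : nbrs W x = set0 ->
  has_edge (W :&: V) = has_edge ((W :\ x) :&: V).
Proof.
move=> /setP N0; apply/idP/idP; last by apply/has_edgeS/setSI/subsetDl.
have not_x i j : j \in W -> e i j -> i != x.
  move=> jW; apply: contraTneq => ->.
  by have := N0 j; rewrite !inE jW => /= ->.
move=> /has_edgeP[i [j []]]; rewrite !inE => /andP[iW iV] /andP[jW jV] eij.
have eji : e j i by rewrite e_sym.
apply/has_edgeP; exists i, j.
by rewrite !inE iW iV jW jV (not_x i j) ?(not_x j i).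
Qed.

End Graphs.

Section EdgeIdeals.
Variables (R : comNzRingType) (n : nat) (e : rel 'I_n).
Hypotheses (e_sym : symmetric e) (e_irr : irreflexive e).
Implicit Types (W V : {set 'I_n}) (x y : 'I_n).

Definition edge_pd_le W p : Prop :=
  squarefree_pd_le R (fun V => has_edge e (W :&: V)) p.

Lemma edge_pd_le_set0 : edge_pd_le set0 0.
Proof.
apply: eq_monomial_pd_le (monomial_pd_le_pred0 R n) => m.
by rewrite set0I has_edge0.
Qed.

Lemma edge_pd_le_isolated W x p :
  nbrs e W x = set0 -> edge_pd_le (W :\ x) p -> edge_pd_le W p.
Proof.
move=> Wx; apply: eq_squarefree_pd_le => V.
by rewrite -(has_edge_isolated e_sym _ Wx).
Qed.

Lemma edge_pd_le_vertex W x p q :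
  x \in W ->
  edge_pd_le (W :\ x :\: nbrs e W x) p -> edge_pd_le (W :\ x) q ->
  edge_pd_le W (maxn (#|nbrs e W x| + p) q.+1).
Proof.
move=> xW pdA pdB.
have upE U V1 V2 : V1 \subset V2 ->
    has_edge e (U :&: V1) -> has_edge e (U :&: V2).
  by move=> sV; apply: has_edgeS; apply: setIS.
have [r maxE] : exists r, maxn (#|nbrs e W x| + p) q.+1 = r.+1.
  by exists (maxn (#|nbrs e W x| + p) q.+1).-1; lia.
rewrite maxE; apply: (squarefree_pd_le_colon (x := x)).
- exact: upE.
- have le_r : (#|nbrs e W x| + p <= r.+1)%N by lia.
  apply: (squarefree_pd_leW le_r).
  apply: eq_squarefree_pd_le (squarefree_pd_le_variables _ _ pdA) => //.
    by move=> V; rewrite (has_edgeU1 e_sym e_irr).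
  - exact: upE.
  move=> z V zN; congr has_edge; apply/setP => i; rewrite !inE.
  by move: zN; rewrite inE; case: (eqVneq i z) => //= -> ->; rewrite andbF.
have le_r : (q <= r)%N by lia.
apply: (squarefree_pd_leW le_r); apply: eq_squarefree_pd_le pdB => V.
by rewrite setIDA [(W :\ x) :&: V]setIC setIDA [W :&: V]setIC.
Qed.

End EdgeIdeals.

Section EdgeIdealMembership.
Variables (k : fieldType) (n : nat) (e : rel 'I_n).
Hypothesis e_irr : irreflexive e.
Implicit Types (f g : {mpoly k[n]}).

Lemma in_edge_idealD f g :
  in_edge_ideal e f -> in_edge_ideal e g -> in_edge_ideal e (f + g).
Proof.
move=> [c ->] [d ->]; exists (fun i j => c i j + d i j).
rewrite -big_split; apply: eq_bigr => i _; rewrite -big_split.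
by apply: eq_bigr => j _; rewrite !mulrDl.
Qed.

Lemma in_edge_ideal_edge i j f : e i j -> in_edge_ideal e (f * 'X_i * 'X_j).
Proof.
move=> eij; exists (fun i' j' => if (i' == i) && (j' == j) then f else 0).
rewrite (bigD1 i) //= [X in _ + X]big1 ?addr0 => [|i' /negbTE i'i]; last first.
  by rewrite big1 // => j' _; rewrite i'i !mul0r.
rewrite (bigD1 j) //= [X in _ + X]big1 ?addr0 ?eqxx // => j' /andP[_ /negbTE].
by move=> ->; rewrite andbF !mul0r.
Qed.

Lemma in_edge_idealE f :
  in_edge_ideal e f <->
  in_monomial_ideal (fun m => has_edge e (mnm_supp m)) f.
Proof.
split=> [[c ->]|].
  apply: big_ind => [|f1 f2|i _]; first exact: in_monomial_ideal0.
    exact: in_monomial_idealD.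
  apply: big_ind => [|f1 f2|j eij]; first exact: in_monomial_ideal0.
    exact: in_monomial_idealD.
  rewrite -mulrA -mpolyXD; apply: in_monomial_idealM.
    by move=> m1 m2; apply: has_edgeS; rewrite mnm_suppD subsetUl.
  rewrite -['X_[_]]scale1r; apply: in_monomial_idealZX; apply/has_edgeP.
  by exists i, j; rewrite mnm_suppD !mnm_supp1 !inE !eqxx orbT.
move: f; apply: in_monomial_ideal_ind => [|f g|c m /has_edgeP[i [j []]]].
- exists (fun _ _ => 0); rewrite big1 // => i _.
  by rewrite big1 // => j _; rewrite !mul0r.
- exact: in_edge_idealD.
rewrite !inE => mi mj eij.
have mE : (m - (U_(i) + U_(j)) + (U_(i) + U_(j)) = m)%MM.
  apply/submK/mnm_lepP => z; rewrite mnmDE !mnm1E.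
  have [iz|iz] := eqVneq i z; last by case: eqVneq => // <-.
  by case: eqVneq => [ji|] /=; [rewrite iz ji e_irr in eij | rewrite -iz].
rewrite -mE mpolyXD mpolyXD mulrA !scalerAl; exact: in_edge_ideal_edge.
Qed.

Lemma pd_le_of_edge_pd_le p : edge_pd_le k e setT p -> pd_le k e p.
Proof.
case=> r0 [g0 [g0E /resolvable_chain [r [g [d [rE gE [dg0 dgE] exd]]]]]].
exists r, g, d; split=> //; split.
  move=> f; rewrite in_edge_idealE; split=> [ef|[v ->]].
    have /gE [v vE] : row_module g0 f%:M.
      apply/g0E; rewrite mxE; apply: in_monomial_ideal_sub ef => m.
      by rewrite setTI.
    by exists v; rewrite -vE mxE.
  have /gE /g0E : row_module g (v *m g) by exists v.
  by apply: in_monomial_ideal_sub => m; rewrite setTI.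
split=> //; split; first by move=> i; case: (exd i).
by split=> // i; case: (exd i).
Qed.

End EdgeIdealMembership.

Lemma leq_ratio_add d p r v :
  (r <= d)%N -> (d.+1 * p <= d * v)%N -> (d.+1 * (p + r) <= d * (v + r.+1))%N.
Proof. by move=> le_rd le_pv; nia. Qed.

Section DeletionRatio.
Variables (R : comNzRingType) (n : nat) (e : rel 'I_n).
Hypotheses (e_sym : symmetric e) (e_irr : irreflexive e).
Implicit Types (W V : {set 'I_n}) (x y : 'I_n).

(* [c] counts vertices deleted earlier, each of which has cost 1. *)
Definition edge_pd_ratio d c W : Prop :=
  exists2 p, edge_pd_le R e W p & (d.+1 * (p + c) <= d * (#|W| + c))%N.

Lemma edge_pd_ratio_isolated d c W y :
  y \in W -> nbrs e W y = set0 -> (c <= d)%N ->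
  edge_pd_ratio d 0 (W :\ y) -> edge_pd_ratio d c W.
Proof.
move=> yW Wy le_cd [p pdp]; rewrite !addn0 => /(leq_ratio_add le_cd) le_p.
exists p; first exact: edge_pd_le_isolated pdp.
by rewrite (cardsD1 y W) yW add1n addSnnS.
Qed.

Lemma edge_pd_ratio_vertex d c W x :
  x \in W -> (#|nbrs e W x| + c <= d)%N ->
  edge_pd_ratio d 0 (W :\ x :\: nbrs e W x) ->
  edge_pd_ratio d c.+1 (W :\ x) -> edge_pd_ratio d c W.
Proof.
move=> xW le_d [p pdp]; rewrite !addn0 => /(leq_ratio_add le_d) le_p.
case=> q pdq le_q.
exists (maxn (#|nbrs e W x| + p) q.+1); first exact: edge_pd_le_vertex.
have cardW : #|W| = #|W :\ x|.+1 by rewrite (cardsD1 x) xW.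
have [_|_] := leqP (#|nbrs e W x| + p)%N q.+1; first by rewrite cardW !addSnnS.
have cardA := cardsDS (nbrs_subD1 e_irr W x).
have le_N := subset_leq_card (nbrs_subD1 e_irr W x).
suff -> : (#|W| + c =
           #|W :\ x :\: nbrs e W x| + (#|nbrs e W x| + c).+1)%N.
  by rewrite [(_ + p)%N]addnC -addnA.
by rewrite cardW cardA addnS addnA subnK.
Qed.

Section Rank.
Variables (disp : Order.disp_t) (T : orderType disp) (h : 'I_n -> T).

Definition lower_set x : {set 'I_n} := [set z | h z <= h x]%O.

Lemma edge_pd_ratio_delete_nbrs d c W y :
  y \in W -> (c <= d)%N ->
  (forall V, V \proper W -> edge_pd_ratio d 0 V) ->
  {in nbrs e W y, forall x,
    (#|nbrs e W x| + #|nbrs e (W :&: lower_set x) y| + c <= d.+1)%N} ->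
  edge_pd_ratio d c W.
Proof.
have [s] := ubnP #|W|; elim: s c W => // s IHs c W leW yW le_cd ratioV le_d.
have [Wy0|[x0 x0N]] := set_0Vmem (nbrs e W y).
  by apply: (edge_pd_ratio_isolated yW) => //; apply/ratioV/properD1.
pose x := [arg min_(x < x0 in nbrs e W y) h x]%O.
have [xN x_min] : x \in nbrs e W y /\
    forall z, z \in nbrs e W y -> (h x <= h z)%O.
  by rewrite /x; case: Order.TotalTheory.arg_minP.
have /andP[xW eyx] : (x \in W) && e y x by rewrite inE in xN.
have yNx := nbrs_sym e_sym yW xN.
have lower_gt0 : (0 < #|nbrs e (W :&: lower_set x) y|)%N.
  by apply/card_gt0P; exists x; rewrite !inE xW eyx lexx.
have deg_x : (#|nbrs e W x| + c <= d)%N by have := le_d x xN; lia.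
have deg_x_gt0 : (0 < #|nbrs e W x|)%N by apply/card_gt0P; exists y.
apply: (edge_pd_ratio_vertex xW deg_x).
  apply: ratioV; apply: sub_proper_trans (subsetDl _ _) _; exact: properD1.
apply: IHs.
- by rewrite (cardsD1 x) xW in leW.
- by rewrite !inE yW andbT; apply: contraTneq eyx => <-; rewrite e_irr.
- by lia.
- by move=> V /proper_sub_trans/(_ (subsetDl _ _)); apply: ratioV.
move=> z; rewrite !inE => /andP[/andP[zx zW] eyz].
have zN : z \in nbrs e W y by rewrite inE zW.
have := le_d z zN.
have := subset_leq_card (nbrsS e z (subsetDl W [set x])).
have -> : nbrs e ((W :\ x) :&: lower_set z) y =
    nbrs e (W :&: lower_set z) y :\ x.
  by apply/setP => i; rewrite !inE -!andbA.
rewrite (cardsD1 x (nbrs e (W :&: lower_set z) y)) !inE xW eyx x_min //=.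
by lia.
Qed.

Lemma edge_pd_ratio_rank d :
  (forall x y, e x y -> (h x <= h y)%O ->
     (#|nbrs e (lower_set y) x| + #|nbrs e (lower_set x) y| <= d.+1)%N) ->
  forall W, edge_pd_ratio d 0 W.
Proof.
move=> le_d W; have [s] := ubnP #|W|; elim: s W => // s IHs W leW.
have [->|[y0 y0W]] := set_0Vmem W.
  by exists 0%N; [apply: edge_pd_le_set0 | rewrite muln0].
pose y := [arg max_(y > y0 in W) h y]%O.
have [yW y_max] : y \in W /\ forall z, z \in W -> (h z <= h y)%O.
  by rewrite /y; case: Order.TotalTheory.arg_maxP.
apply: (edge_pd_ratio_delete_nbrs yW) => // [V|x xN].
  by move=> /proper_card ltV; apply: IHs; apply: leq_trans ltV _.
have /andP[xW eyx] : (x \in W) && e y x by rewrite inE in xN.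
have exy : e x y by rewrite e_sym.
rewrite addn0; apply: leq_trans (le_d x y exy (y_max x xW)).
apply: leq_add; apply/subset_leq_card/nbrsS; last exact: subsetIr.
by apply/subsetP => z zW; rewrite inE y_max.
Qed.

End Rank.
End DeletionRatio.

Lemma leq_card_inj_cover (T U : finType) (X : eqType) (f : T -> X) (g : U -> X)
    (A : {set T}) (B : {set U}) :
  injective f -> (forall x, x \in A -> exists2 y, y \in B & f x = g y) ->
  (#|A| <= #|B|)%N.
Proof.
move=> f_inj AB; rewrite !cardE -(size_map f) -(size_map g).
apply: uniq_leq_size; first by rewrite map_inj_uniq ?enum_uniq.
move=> _ /mapP[x + ->]; rewrite mem_enum => /AB[y yB ->].
by apply: map_f; rewrite mem_enum.
Qed.

Lemma leq_card_le_ge (disp : Order.disp_t) (X : orderType disp) (T : finType)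
    (f : T -> X) (t : X) :
  injective f ->
  (#|[set x | f x <= t]%O| + #|[set x | t <= f x]%O| <= #|T|.+1)%N.
Proof.
move=> f_inj; rewrite -cardsUI -addn1 leq_add ?max_card //.
apply/card_le1_eqP => x y; rewrite !inE => /le_anti fx /le_anti fy.
by apply: f_inj; rewrite fx.
Qed.

Section Lattice.
Variable l : nat.
Implicit Types (p q : {ffun 'I_l -> int}) (cb : 'I_l * bool).

Definition lattice_step cb : {ffun 'I_l -> int} :=
  [ffun c => if c == cb.1 then (-1) ^+ cb.2 else 0].

Definition height p : int := \sum_(c < l) p c * c.+1%:Z.

Lemma lattice_adj_step p q :
  lattice_adj p q -> exists cb, p - q = lattice_step cb.
Proof.
set v := p - q => /eqP; rewrite (eq_bigr (fun c => v c ^+ 2)); last first.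
  by move=> c _; rewrite !ffunE.
move=> sum1; have sq_ge0 c : 0 <= v c ^+ 2 by apply: sqr_ge0.
have [c vc0] : exists c, v c != 0.
  apply/existsP; apply: contra_eqT sum1 => /existsPn v0.
  by rewrite big1 // => c _; have /negPn/eqP -> := v0 c.
have rest_ge0 : 0 <= \sum_(j < l | j != c) v j ^+ 2 by apply: sumr_ge0.
have vc_ge1 : 1 <= v c ^+ 2 by rewrite -gtz0_ge1 lt_def sq_ge0 sqrf_eq0 vc0.
move: sum1; rewrite (bigD1 c) //= => sum1.
have vc_sq : v c ^+ 2 = 1.
  by apply/eqP; rewrite eq_le vc_ge1 andbT -sum1 lerDl.
have rest0 : \sum_(j < l | j != c) v j ^+ 2 = 0.
  by apply: (addrI (v c ^+ 2)); rewrite sum1 addr0 vc_sq.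
have vc1 : (v c == 1) || (v c == -1) by rewrite -sqrf_eq1 vc_sq.
exists (c, v c == -1); apply/ffunP => j; rewrite [RHS]ffunE /=.
have [->|jc] := eqVneq j c; first by case/orP: vc1 => /eqP ->.
have /eqP := psumr_eq0P (fun i _ => sq_ge0 i) rest0 jc.
by rewrite sqrf_eq0 => /eqP.
Qed.

Lemma heightB p q : height (p - q) = height p - height q.
Proof.
by rewrite -sumrB; apply: eq_bigr => c _; rewrite !ffunE mulrBl.
Qed.

Lemma height_step cb : height (lattice_step cb) = (-1) ^+ cb.2 * cb.1.+1%:Z.
Proof.
rewrite /height (bigD1 cb.1) //= ffunE eqxx big1 ?addr0 // => c /negbTE cb1.
by rewrite ffunE cb1 mul0r.
Qed.

Lemma height_step_inj : injective (height \o lattice_step).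
Proof.
move=> [c b] [c' b'] /=; rewrite !height_step /= => eq_h.
have [] : c = c' :> nat /\ b = b'.
  by case: b b' eq_h => [] [] /=; rewrite ?expr1 ?expr0 ?mulN1r ?mul1r; lia.
by move=> /val_inj -> ->.
Qed.

Lemma card_lower_lattice_nbrs n (pos : 'I_n -> {ffun 'I_l -> int})
    (e : rel 'I_n) x y :
  injective pos -> symmetric e ->
  (forall i j, e i j -> lattice_adj (pos i) (pos j)) -> e x y ->
  (#|nbrs e (lower_set (height \o pos) y) x| +
   #|nbrs e (lower_set (height \o pos) x) y| <= (2 * l).+1)%N.
Proof.
move=> pos_inj e_sym e_lat exy; set t := height (pos y) - height (pos x).
have -> : (2 * l = #|{: 'I_l * bool}|)%N.
  by rewrite card_prod card_ord card_bool mulnC.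
apply: leq_trans (leq_card_le_ge t height_step_inj); apply: leq_add.
  apply: (leq_card_inj_cover (g := fun cb => pos x + lattice_step cb) pos_inj).
  move=> z; rewrite !inE => /andP[le_zy exz].
  have [cb zE] : exists cb, pos z - pos x = lattice_step cb.
    by apply: lattice_adj_step; apply: e_lat; rewrite e_sym.
  exists cb; last by rewrite -zE addrC subrK.
  by rewrite inE /= -zE heightB lerD2r.
apply: (leq_card_inj_cover (g := fun cb => pos y - lattice_step cb) pos_inj).
move=> z; rewrite !inE => /andP[le_zx eyz].
have [cb zE] := lattice_adj_step (e_lat _ _ eyz).
exists cb; last by rewrite -zE opprB addrC subrK.
by rewrite inE /= -zE heightB lerD2l lerN2.
Qed.

End Lattice.

Theorem theorem3p7 (k : fieldType) (l n : nat) (hl : (1 <= l)%N)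
  (pos : 'I_n -> {ffun 'I_l -> int}) (pos_inj : injective pos)
  (e : rel 'I_n) (e_sym : symmetric e) (e_irr : irreflexive e)
  (e_lat : forall i j, e i j -> lattice_adj (pos i) (pos j)) :
  exists p : nat, pd_le k e p /\ ((2 * l + 1) * p <= 2 * l * n)%N.
Proof.
have [x y exy _|p pdp le_p] := edge_pd_ratio_rank k e_sym e_irr
  (h := @height l \o pos) (d := (2 * l)%N) _ setT.
  exact: card_lower_lattice_nbrs.
exists p; split; first exact: pd_le_of_edge_pd_le.
by move: le_p; rewrite !addn0 cardsT card_ord addn1.
Qed.
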